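(* Consider the adaptive shortest-path routing problem with light-tailed edge costs described in the context, with path-set dimension $d$. Let $f(t)$ be any positive increasing sequence with $f(t)\to\infty$ as $t\to\infty$. Construct the exploration sequence by $\mathcal{A}(1)=\{1\}$ and, for each $t>1$: $\mathcal{A}(t)=\mathcal{A}(t-1)\cup\{t\}$ if $|\mathcal{A}(t-1)|<d\lceil f(t)\log t\rceil$, and $\mathcal{A}(t)=\mathcal{A}(t-1)$ otherwise. Let $\pi'$ be the Adaptive Shortest-Path Routing Algorithm (defined in the context) run with this exploration sequence. Then $$R^{\pi'}(T)=O\big(d\,f(T)\log T\big).$$
   Context: Problem. $G=(V,E)$ is a finite directed graph consisting of all simple paths from a source $s$ to a destination $r$; $m=|E|$, and $\mathcal{P}$ is the (finite) set of all paths from $s$ to $r$ in $G$. At each time $t=1,2,\dots$ each edge $e\in E$ is assigned a random cost $W_e(t)$ with unknown distribution; the cost vectors $(W_e(t))_{e\in E}$ are i.i.d. over $t$. At each time $t$ a policy $\pi$ chooses, based on past observations, a path $p\in\mathcal{P}$, and then only the total cost $C_t(p)=\sum_{e\in p}W_e(t)$ is observed (individual edge costs are not). $C_t(\pi)$ denotes the total cost of the path chosen by $\pi$ at time $t$. Let $\sigma(1)$ be a path of minimum expected cost. The regret is $R^{\pi}(T)=\mathbb{E}\big[\sum_{t=1}^T (C_t(\pi)-C_t(\sigma(1)))\big]$. Light-tailed costs. A random variable $X$ is light-tailed if there is $u_0>0$ with $\mathbb{E}[\exp(uX)]<\infty$ for all $|u|\le u_0$. All edge costs $W_e(t)$ are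 light-tailed. No knowledge of the cost distributions is used by the policy. Path vectors and barycentric spanner. Each path $p$ is identified with its $0/1$ incidence vector $\vec p\in\mathbb{R}^m$ (entry $1$ iff the edge is on the path); $d\le m$ is the dimension of the linear span of all path vectors. A barycentric spanner of the path set is a set $B=\{\vec p_1,\dots,\vec p_d\}$ of $d$ path vectors such that every path vector is a linear combination of elements of $B$ with coefficients in $[-1,1]$. Such a $B$ exists and is fixed; its paths are denoted $p_1,\dots,p_d$. Algorithm. $\mathcal{A}(t)\subseteq\{1,\dots,t\}$ is the set of exploration times up to and including $t$, with $|\mathcal{A}(t)|$ its cardinality. For positive integers $k,l$ let $k\oslash l=((k-1)\bmod l)+1$. Let $\overline\theta_{p_i}(t)$ ($i=1,\dots,d$) be the sample mean of the past cost observations on path $p_i$. At time $t$: if $t\in\mathcal{A}(t)$, choose path $p_n$ with $n=|\mathcal{A}(t)|\oslash d$. If $t\notin\mathcal{A}(t)$, then for every $p\in\mathcal{P}$ write $\vec p=\sum_{i=1}^d a_i\vec p_i$ with $|a_i|\le1$, set $\overline\theta_p(t)=\sum_{i=1}^d a_i\overline\theta_{p_i}(t)$, and choose a path minimizing $\overline\theta_p(t)$ over $p\in\mathcal{P}$. *)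

(* Defs.v *)
From HB Require Import structures.
From mathcomp Require Import all_boot all_order all_algebra finmap.
From mathcomp Require Import all_classical all_reals all_analysis.

Set Implicit Arguments.
Unset Strict Implicit.
Unset Printing Implicit Defensive.

Import Order.TTheory GRing.Theory Num.Theory.
Import numFieldNormedType.Exports.

Local Open Scope classical_set_scope.
Local Open Scope ring_scope.

Section Graph.
Context (V : finType) (E : {set V * V}) (s r : V).

(* A path from s to r is the list of the vertices that follow s. *)
Definition is_simple_path (p : seq V) : bool :=
  [&& path [rel u v | (u, v) \in E] s p, uniq (s :: p) & last s p == r].

(* The length bound excludes no simple path; it only makes the type finite. *)
Lemma size_simple_path (p : seq V) : is_simple_path p -> (size p <= #|V|)%N.
Proof.
case/and3P => _ /card_uniqP up _; apply: ltnW.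
by rewrite -[(size p).+1]/(size (s :: p)) -up max_card.
Qed.

Definition spath : predArgType := {p : {bseq #|V| of V} | is_simple_path p}.

Definition path_verts (p : spath) : seq V := s :: \val p.

Definition path_edges (p : spath) : seq (V * V) := zip (path_verts p) (\val p).

Definition union_of_simple_paths : Prop :=
  (forall v : V, exists p : spath, v \in path_verts p) /\
  (forall e : V * V, e \in E -> exists p : spath, e \in path_edges p).

(* The coordinates of R^m, m = #|E|, are numbered along enum E: coordinate j
   belongs to the edge enum_val j. *)
Definition on_path (p : spath) (j : 'I_#|E|) : bool :=
  enum_val j \in path_edges p.

Section PathVectors.
Context (R : realType).

Definition pvec (p : spath) : 'rV[R]_#|E| := \row_j (on_path p j)%:R.

Definition path_dim : nat := \dim <<[seq pvec p | p : spath]>>%VS.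

Definition spanner_coefs (B : 'I_path_dim -> spath)
    (a : spath -> 'I_path_dim -> R) : Prop :=
  forall p, (forall i, `|a p i| <= 1) /\ pvec p = \sum_i a p i *: pvec (B i).

Definition barycentric_spanner (B : 'I_path_dim -> spath) : Prop :=
  injective (pvec \o B) /\ exists a, spanner_coefs B a.

End PathVectors.
End Graph.

(* Sequences of random variables are indexed by the times t = 1, 2, ...;
   the value at 0 is unconstrained and never used. *)
Section Randomness.
Context (dO : measure_display) (Omega : measurableType dO) (R : realType)
        (P : probability Omega R).

Definition independent_seq (dT : measure_display) (T : measurableType dT)
    (X : nat -> {RV P >-> T}) : Prop :=
  forall (J : seq nat) (B : nat -> set T),
    uniq J -> all (leq 1) J -> (forall t, measurable (B t)) ->
    P (\bigcap_(t in [set` J]) (X t @^-1` B t)) =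
    (\prod_(t <- J) P (X t @^-1` B t))%E.

Definition identically_distributed_seq (dT : measure_display)
    (T : measurableType dT) (X : nat -> {RV P >-> T}) : Prop :=
  forall (t u : nat) (B : set T), (0 < t)%N -> (0 < u)%N -> measurable B ->
    distribution P (X t) B = distribution P (X u) B.

Definition light_tailed (X : Omega -> R) : Prop :=
  exists2 u0 : R, 0 < u0 & forall u, `|u| <= u0 -> ('M_P X u < +oo)%E.

End Randomness.

Section Exploration.
Context (R : realType) (d : nat) (f : nat -> R).
Local Open Scope fset_scope.

(* explore t is A(t); A(0) is empty, so that t = 1 always joins. *)
Fixpoint explore (t : nat) : {fset nat} :=
  if t is t'.+1 then
    let A := explore t' in
    if (t' == 0%N) || ((#|` A|%:Z < d%:Z * Num.ceil (f t * ln t%:R))%R)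
    then t |` A else A
  else fset0.

End Exploration.

Definition oslash (k l : nat) : nat := ((k - 1) %% l).+1.

Section Routing.
Context (V : finType) (E : {set V * V}) (s r : V) (R : realType).
Let pathT := spath E s r.
Let d := path_dim E s r R.

(* Chronological list of the pairs (chosen path, observed total cost). *)
Definition history : Type := seq (pathT * R).

Section Algorithm.
Context (B : 'I_d -> pathT) (a : pathT -> 'I_d -> R) (f : nat -> R).

(* Every past observation of the path counts, made while exploring or not. *)
Definition sample_mean (h : history) (q : pathT) : R :=
  let obs := [seq x.2 | x <- h & x.1 == q] in
  (\sum_(c <- obs) c) / (size obs)%:R.

Definition path_estimate (h : history) (p : pathT) : R :=
  \sum_i a p i * sample_mean h (B i).

(* p_1, ..., p_d are B 0, ..., B (d - 1); ties between minimizing paths are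
   broken arbitrarily. *)
Definition asr_choice (h : history) (q : pathT) : Prop :=
  let t := (size h).+1 in
  let A := explore d f t in
  if t \in A then exists2 i : 'I_d, i.+1 = oslash #|` A|%fset d & q = B i
  else forall p, path_estimate h q <= path_estimate h p.

Definition is_asr_policy (pi : history -> pathT) : Prop :=
  forall h, asr_choice h (pi h).

End Algorithm.

Definition measurable_policy (pi : history -> pathT) : Prop :=
  forall (n : nat) (ps : n.-tuple pathT) (q : pathT),
    measurable [set c : n.-tuple R | pi (zip ps c) = q].

Section Regret.
Context (dO : measure_display) (Omega : measurableType dO)
        (P : probability Omega R) (W : nat -> {RV P >-> #|E|.-tuple R}).

Definition path_cost (t : nat) (p : pathT) (w : Omega) : R :=
  \sum_(j < #|E| | on_path p j) tnth (W t w) j.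

Definition min_expected_cost (q : pathT) : Prop :=
  forall t, (0 < t)%N ->
  forall p, ('E_P[path_cost t q] <= 'E_P[path_cost t p])%E.

Context (pi : history -> pathT).

(* The history after the times 1, ..., t. *)
Fixpoint run (w : Omega) (t : nat) : history :=
  if t is t'.+1 then
    let h := run w t' in rcons h (pi h, path_cost t (pi h) w)
  else [::].

Definition policy_cost (t : nat) (w : Omega) : R :=
  path_cost t (pi (run w t.-1)) w.

Definition regret (sigma1 : pathT) (T : nat) : \bar R :=
  'E_P[fun w => \sum_(1 <= t < T.+1) (policy_cost t w - path_cost t sigma1 w)].

End Regret.
End Routing.

(* Main.v *)
(* The total cost observed on a path q at the times when q is chosen is handled
   by a nonnegative supermartingale: if E[G(cost of q)] <= 1 then the product of
   G over all costs observed so far on q has expectation at most 1, because the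
   choice made at time n+1 depends only on the past and is independent of the
   fresh costs.  With G(c) = exp(u(+-(c - theta)) - u delta + kappa), which has
   mean at most 1 for small u and kappa because the costs are light-tailed, this
   product is at least exp(kappa k) as soon as q has been observed k times or more
   and its sample mean is off by delta.  No union bound over the random number of
   observations is needed.

   Exploitation at time t occurs only when each path of the spanner has been
   observed at least f(t) log t times.  Coefficients in [-1, 1] turn accurate
   spanner means into accurate means of all paths, so a suboptimal choice has
   probability at most 2 d t^(-kappa f(t)), eventually below 2 d t^(-2), which is
   summable.  Exploration occurs at most 1 + d (f(T) log T + 1) times. *)

From HB Require Import structures.
Require Import Defs.
From mathcomp Require Import all_boot all_order all_algebra finmap.
From mathcomp Require Import all_classical all_reals all_analysis.
From mathcomp Require Import measurable_realfun.
From mathcomp Require Import ring lra zify.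

Import Order.TTheory GRing.Theory Num.Theory.
Import numFieldNormedType.Exports.

Local Open Scope classical_set_scope.
Local Open Scope ring_scope.

Set Implicit Arguments.
Unset Strict Implicit.
Unset Printing Implicit Defensive.

(** * Independence of the past and the present *)

Section Independence.
Local Open Scope ereal_scope.
Context (d d1 d2 : measure_display) (Omega : measurableType d)
  (T1 : measurableType d1) (T2 : measurableType d2) (R : realType)
  (P : probability Omega R).

(** The joint law of the pair agrees with the product law on rectangles, hence everywhere; Tonelli
    then separates the two factors. *)
Lemma ge0_integralM_indep (X : {mfun Omega >-> T1}) (Y : {mfun Omega >-> T2})
    (F : T1 -> \bar R) (g : T2 -> \bar R) :
  (forall A B, measurable A -> measurable B ->
    P (X @^-1` A `&` Y @^-1` B) = P (X @^-1` A) * P (Y @^-1` B)) ->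
  measurable_fun setT F -> (forall x, 0 <= F x) ->
  measurable_fun setT g -> (forall y, 0 <= g y) ->
  \int[P]_w (F (X w) * g (Y w)) = \int[P]_w F (X w) * \int[P]_w g (Y w).
Proof.
move=> XY mF F0 mg g0.
pose phi w := (X w, Y w).
have mphi : measurable_fun setT phi by exact: measurable_fun_pair.
pose phi' : {mfun Omega >-> (T1 * T2)%type} :=
  HB.pack phi (isMeasurableFun.Build _ _ _ _ _ mphi).
pose h (z : T1 * T2) := F z.1 * g z.2.
have mh : measurable_fun setT h.
  by apply: emeasurable_funM; exact: measurableT_comp.
have h0 z : 0 <= h z by rewrite mule_ge0.
transitivity (\int[distribution P phi']_z h z).
  by rewrite ge0_integral_distribution.
have -> : \int[distribution P phi']_z h z =
    \int[distribution P X \x distribution P Y]_z h z.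
  apply: eq_measure_integral => A mA _; apply/esym.
  by apply: product_measure_unique => // B C mB mC; rewrite -XY.
rewrite fubini_tonelli1// /fubini_F /h/=.
under eq_integral do rewrite ge0_integralZl//.
rewrite ge0_integralZr//; last exact: integral_ge0.
by rewrite !ge0_integral_distribution.
Qed.

End Independence.

Lemma indep_setC (d : measure_display) (Omega : measurableType d)
    (R : realType) (P : probability Omega R) (A B : set Omega) :
  measurable A -> measurable B -> P (A `&` B) = (P A * P B)%E ->
  P (~` A `&` B) = (P (~` A) * P B)%E.
Proof.
move=> mA mB AB; have PB : P B \is a fin_num by exact: fin_num_measure.
rewrite setIC -setDE measureD// ?ltey_eq ?PB//.
rewrite [X in (_ - X)%E](_ : _ = (P A * P B)%E) 1?setIC// probability_setC//.
by rewrite muleBl ?mul1e// fin_num_adde_defl// fin_numN fin_num_measure.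
Qed.

Section Past.
Local Open Scope ereal_scope.
Context (dO dT : measure_display) (Omega : measurableType dO)
  (T : measurableType dT) (R : realType) (P : probability Omega R)
  (W : nat -> {RV P >-> T}).

(** These rectangles form a pi-system that generates the sigma-algebra of the cost vectors at times
    1 to [n]. *)
Definition cylinders (n : nat) : set (set Omega) :=
  [set A | exists2 B : nat -> set T, (forall t, measurable (B t)) &
     A = \bigcap_(t in [set` iota 1 n]) (W t @^-1` B t)].

(** A copy of [Omega] with a coarser sigma-algebra: measurability on [past n] expresses being
    determined by the first [n] observations of [W]. *)
Definition past (n : nat) := g_sigma_algebraType (cylinders n).

Lemma cylinders_setI_closed n : setI_closed (cylinders n).
Proof.
move=> _ _ [B mB ->] [C mC ->]; exists (fun t => B t `&` C t).
  by move=> t; exact: measurableI.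
by rewrite -bigcapI.
Qed.

Lemma measurable_cylinder n A : cylinders n A -> measurable A.
Proof.
move=> [B mB ->]; apply: fin_bigcap_measurable => // t _.
by rewrite -[X in measurable X]setTI; exact: measurable_funPT.
Qed.

Lemma measurable_past n (A : set (past n)) :
  measurable A -> measurable (A : set Omega).
Proof.
apply: smallest_sub; first exact: sigma_algebra_measurable.
exact: measurable_cylinder.
Qed.

Lemma cylindersS n A : cylinders n A -> cylinders n.+1 A.
Proof.
(* [B] is arbitrary at time [n.+1], which now counts, so it is replaced there by the trivial
   constraint [setT]. *)
move=> [B mB ->]; exists (fun t => if (t <= n)%N then B t else setT).
  by move=> t; case: ifP.
rewrite !bigcap_seq -(addn1 n) iotaD big_cat/= big_seq1 add1n ltnn preimage_setT setIT.
rewrite big_seq [RHS]big_seq; apply: eq_bigr => t.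
by rewrite mem_iota add1n ltnS => /andP[_ ->].
Qed.

Lemma measurable_fun_pastS n d' (T' : measurableType d') (F : past n -> T') :
  measurable_fun setT F -> measurable_fun setT (F : past n.+1 -> T').
Proof.
move=> mF _ A mA; have := mF measurableT A mA.
apply: smallest_sub; first exact: smallest_sigma_algebra.
by move=> B /cylindersS; exact: sub_gen_smallest.
Qed.

Lemma measurable_fun_past n d' (T' : measurableType d') (F : past n -> T') :
  measurable_fun setT F -> measurable_fun setT (F : Omega -> T').
Proof. by move=> mF _ A mA; apply: measurable_past; exact: mF. Qed.

Lemma measurable_past_obs n :
  measurable_fun setT (W n.+1 : past n.+1 -> T).
Proof.
move=> _ A mA; apply: sub_gen_smallest.
exists (fun t => if t == n.+1 then A else setT).
  by move=> t; case: ifP.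
rewrite setTI bigcap_seq -(addn1 n) iotaD big_cat/= big_seq1 add1n addn1 eqxx.
rewrite big_seq big1 ?setTI// => t.
rewrite mem_iota add1n ltnS => /andP[_ tn].
by rewrite (ltn_eqF (_ : t < n.+1)%N)// preimage_setT.
Qed.

Hypothesis Windep : independent_seq W.

(** The events independent of the fresh observation form a Dynkin class, and the cylinders are
    stable under intersection, so checking the cylinders suffices. *)
Lemma past_indep n (A : set (past n)) (B : set T) :
  measurable A -> measurable B ->
  P (A `&` W n.+1 @^-1` B) = P A * P (W n.+1 @^-1` B).
Proof.
move=> mA mB.
have mY : measurable (W n.+1 @^-1` B).
  by rewrite -[X in measurable X]setTI; exact: measurable_funPT.
move: A mA; apply: dynkin_induction => //=.
- exact: cylinders_setI_closed.
- by rewrite setTI probability_setT mul1e.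
- move=> _ [C mC ->].
  (* Gluing [B] onto [C] at time [n.+1] turns the intersection into a single cylinder; the product
     formula is then used at both lengths, [n.+1] and [n]. *)
  pose D t := if t == n.+1 then B else C t.
  have mD t : measurable (D t) by rewrite /D; case: ifP.
  have -> : \bigcap_(t in [set` iota 1 n]) (W t @^-1` C t) =
      \bigcap_(t in [set` iota 1 n]) (W t @^-1` D t).
    rewrite !bigcap_seq big_seq [RHS]big_seq; apply: eq_bigr => t.
    rewrite mem_iota add1n ltnS /D => /andP[_ tn].
    by rewrite (ltn_eqF (_ : t < n.+1)%N).
  have -> : B = D n.+1 by rewrite /D eqxx.
  have iotaS : iota 1 n.+1 = iota 1 n ++ [:: n.+1].
    by rewrite -(addn1 n) iotaD add1n addn1.
  have pos m : all (leq 1) (iota 1 m).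
    by apply/allP => t; rewrite mem_iota => /andP[].
  have := Windep (iota_uniq 1 n.+1) (pos _) mD.
  rewrite iotaS bigcap_seq !big_cat/= !big_seq1 -bigcap_seq => ->.
  by rewrite -(Windep (iota_uniq 1 n) (pos _) mD).
- move=> S /measurable_past mS PS.
  exact: indep_setC.
- move=> F mF tF PF.
  have mF' k : measurable (F k : set Omega) by exact: measurable_past.
  rewrite setI_bigcupl !measure_bigcup//=; last 2 first.
  - by move=> k _; exact: measurableI.
  - apply/trivIsetP => i j _ _ ij; move/trivIsetP : tF => /(_ _ _ I I ij) FF.
    by rewrite setIACA FF set0I.
  under eq_eseriesr do rewrite PF muleC.
  have /fineK <- : P (W n.+1 @^-1` B) \is a fin_num by exact: fin_num_measure.
  by rewrite nneseriesZl// muleC.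
Qed.

Lemma ge0_integralM_past n (F : past n -> \bar R) (g : T -> \bar R) :
  measurable_fun setT F -> (forall w, 0 <= F w) ->
  measurable_fun setT g -> (forall x, 0 <= g x) ->
  \int[P]_w (F w * g (W n.+1 w)) = \int[P]_w F w * \int[P]_w g (W n.+1 w).
Proof.
move=> mF F0 mg g0.
have mid : measurable_fun setT (idfun : Omega -> past n).
  by move=> _ A /measurable_past mA; rewrite setTI preimage_id.
(* The whole past is one random variable: the identity from [Omega] to its coarser copy. *)
pose X : {mfun Omega >-> past n} :=
  HB.pack (idfun : Omega -> past n) (isMeasurableFun.Build _ _ _ _ _ mid).
by apply: (ge0_integralM_indep (X := X)) => // A B; exact: past_indep.
Qed.

End Past.

Section SignedIntegralPast.
Local Open Scope ereal_scope.
Context (dO dT : measure_display) (Omega : measurableType dO)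
  (T : measurableType dT) (R : realType) (P : probability Omega R)
  (W : nat -> {RV P >-> T}).
Hypothesis Windep : independent_seq W.

(** Path costs may be negative, so the nonnegative product rule is applied to the positive and
    negative parts of [g], with which the indicator commutes; integrability makes their difference
    meaningful. *)
Lemma integral_indicM_past n (A : set (past W n)) (g : T -> R) :
  measurable A -> measurable_fun setT g ->
  P.-integrable setT (fun w => (g (W n.+1 w))%:E) ->
  \int[P]_w (\1_A w * g (W n.+1 w))%:E = P A * \int[P]_w (g (W n.+1 w))%:E.
Proof.
move=> mA mg ig.
have mI : measurable_fun setT (fun w : past W n => (\1_A w)%:E : \bar R).
  exact/measurable_EFinP/measurable_indic.
have mgE : measurable_fun setT (EFin \o g) by exact/measurable_EFinP.
have key (h : T -> \bar R) : measurable_fun setT h -> (forall x, 0 <= h x) ->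
    \int[P]_w ((\1_A w)%:E * h (W n.+1 w)) = P A * \int[P]_w h (W n.+1 w).
  move=> mh h0.
  rewrite (ge0_integralM_past Windep (F := fun w => (\1_A w)%:E))//.
  by rewrite integral_indic ?setIT//; exact: measurable_past mA.
rewrite integralE [in RHS]integralE.
transitivity (P A * \int[P]_w (EFin \o g)^\+ (W n.+1 w) -
              P A * \int[P]_w (EFin \o g)^\- (W n.+1 w)).
  rewrite -!key//; [|exact: measurable_funeneg|exact: measurable_funepos].
  congr (_ - _); apply: eq_integral => w _.
    by rewrite !funeposE maxe_pMr ?mule0// EFinM.
  by rewrite !funenegE maxe_pMr ?mule0 ?muleN// EFinM.
rewrite [in RHS]muleBr ?fin_num_adde_defr ?integrable_pos_fin_num//.
  by congr (_ * _ - _ * _); apply: eq_integral => w _; rewrite ?funeposE ?funenegE.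
exact: (fin_num_measure _ _ (measurable_past mA)).
Qed.

End SignedIntegralPast.

(** * Histories and the supermartingale *)

Section Play.
Context (V : finType) (E : {set V * V}) (s r : V) (R : realType)
  (dO : measure_display) (Omega : measurableType dO) (P : probability Omega R)
  (W : nat -> {RV P >-> #|E|.-tuple R}).
Variable pi : history E s r R -> spath E s r.
Hypothesis pi_meas : measurable_policy pi.
Hypothesis Windep : independent_seq W.

(** [path_cost W t p] is this function composed with [W t]; isolating it lets integrals be
    transferred through the law of [W t]. *)
Definition tuple_cost (p : spath E s r) (x : #|E|.-tuple R) : R :=
  \sum_(j < #|E| | on_path p j) tnth x j.

Lemma measurable_tuple_cost p : measurable_fun setT (tuple_cost p).
Proof.
rewrite /tuple_cost; under eq_fun do rewrite -big_filter.
by apply: measurable_sum => j; exact: measurable_tnth.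
Qed.

Lemma measurable_path_cost t (p : spath E s r) :
  measurable_fun setT (path_cost W t p).
Proof.
by apply: (measurableT_comp (measurable_tuple_cost p)); exact: measurable_funPT.
Qed.

Lemma measurable_past_cost n t (p : spath E s r) : (0 < t <= n)%N ->
  measurable_fun setT (path_cost W t p : past W n -> R).
Proof.
elim: n => [|n IH]; first by case: t.
move=> /andP[t0]; rewrite leq_eqVlt => /orP[/eqP ->|tn].
  apply: (measurableT_comp (measurable_tuple_cost p)).
  exact: measurable_past_obs.
by apply: measurable_fun_pastS; apply: IH; rewrite t0.
Qed.

Lemma size_run w n : size (run W pi w n) = n.
Proof. by elim: n => //= n IH; rewrite size_rcons IH. Qed.

(** [measurable_policy] speaks of histories [zip ps c] with [ps] fixed. Once the chosen paths are
    known, the run has this form, with costs that are explicit functions of the observations. *)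
Lemma run_zip w n (ps : n.-tuple (spath E s r)) :
  unzip1 (run W pi w n) = ps ->
  run W pi w n = zip ps [tuple path_cost W i.+1 (tnth ps i) w | i < n].
Proof.
move=> run_ps.
have runE m : unzip2 (run W pi w m) =
    [seq path_cost W it.1 it.2 w | it <- zip (iota 1 m) (unzip1 (run W pi w m))].
  elim: m => //= m IH; rewrite /unzip2 /unzip1 !map_rcons -/(iota 1 m.+1).
  rewrite -(addn1 m) iotaD add1n/= cats1 zip_rcons ?size_map ?size_iota ?size_run//.
  by rewrite map_rcons -IH addn1.
rewrite -[LHS]zip_unzip run_ps; congr zip.
rewrite runE run_ps; apply: (@eq_from_nth _ 0).
  by rewrite size_map size_zip size_iota !size_tuple minnn.
move=> i; rewrite size_map size_zip size_iota size_tuple minnn => ilt.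
(* [nth] needs a default path, and [spath] has no canonical inhabitant. *)
have p0 := tnth ps (Ordinal ilt).
rewrite (nth_map (0%N, p0)) ?size_zip ?size_iota ?size_tuple ?minnn//.
rewrite nth_zip ?size_iota ?size_tuple//= nth_iota// add1n.
rewrite [RHS](_ : _ = tnth [tuple path_cost W k.+1 (tnth ps k) w | k < n]
  (Ordinal ilt)); last by rewrite (tnth_nth 0).
by rewrite tnth_mktuple (tnth_nth p0).
Qed.

(** There are finitely many lists of [n] paths. Where a given list has been chosen, the observed
    costs are fixed measurable functions of the past, so the measurability of the policy applies;
    the event is the finite union of these pieces. *)
Lemma measurable_choice n q :
  measurable ([set w | pi (run W pi w n) = q] : set (past W n)).
Proof.
pose paths_event m l : set (past W m) := [set w | unzip1 (run W pi w m) = l].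
(* Choice events are obtained from path-list events at the same time, and path-list events at the
   next time from both, so the induction below only carries the latter. *)
have choice k : (forall l, measurable (paths_event k l)) ->
    forall q', measurable ([set w | pi (run W pi w k) = q'] : set (past W k)).
  move=> mpaths q'.
  pose C (ps : k.-tuple (spath E s r)) (w : past W k) :=
    [tuple path_cost W i.+1 (tnth ps i) w | i < k].
  have -> : [set w | pi (run W pi w k) = q'] =
    \bigcup_(ps in [set: k.-tuple (spath E s r)])
     (paths_event k ps `&` C ps @^-1` [set c : k.-tuple R | pi (zip ps c) = q']).
    apply/seteqP; split => w /=.
      move=> wq; have sz : size (unzip1 (run W pi w k)) == k.
        by rewrite size_map size_run.
      by exists (Tuple sz) => //=; split => //; rewrite -(run_zip (ps := Tuple sz)).
    by move=> [ps _ [/= wps]]; rewrite -run_zip.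
  apply: fin_bigcup_measurable => [|ps _]; first exact: finite_finset.
  apply: measurableI; first exact: mpaths.
  rewrite -[X in measurable X]setTI.
  have : measurable_fun setT (C ps).
    apply/measurable_fun_tnthP => i.
    rewrite (_ : _ \o _ = path_cost W i.+1 (tnth ps i)).
      by apply: measurable_past_cost; rewrite /= ltn_ord.
    by apply/funext => w /=; rewrite tnth_mktuple.
  by apply => //; exact: pi_meas.
suff mpaths m l : measurable (paths_event m l) by exact: choice.
elim: m l => [|m IH] l.
  have [<-|l0] := eqVneq [::] l.
    by rewrite (_ : paths_event _ _ = setT)//; apply/seteqP.
  rewrite (_ : paths_event _ _ = set0)//; apply/seteqP; split => // w /= /eqP.
  by rewrite (negbTE l0).
case/lastP: l => [|l q'].
  rewrite (_ : paths_event _ _ = set0)//; apply/seteqP; split => // w.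
  by rewrite /paths_event/= /unzip1 map_rcons => /(congr1 size); rewrite size_rcons.
have -> : paths_event m.+1 (rcons l q') =
  paths_event m l `&` [set w | pi (run W pi w m) = q'].
  apply/seteqP; split => w; rewrite /paths_event /= /unzip1 map_rcons/=.
    by move/eqP; rewrite eqseq_rcons => /andP[/eqP -> /eqP ->].
  by move=> [-> ->].
have sub A : measurable (A : set (past W m)) -> measurable (A : set (past W m.+1)).
  move=> mA; rewrite -[A]setTI -[A]/(id @^-1` A).
  by apply: (@measurable_fun_pastS _ _ _ _ _ _ W m _ _ id).
by apply: measurableI; apply: sub; [exact: IH|exact: choice].
Qed.

(* The wealth process of a gambler who multiplies the fortune by G(c) each time a
   cost c is observed on q. *)
Definition stake (q : spath E s r) (G : R -> R) (h : history E s r R) : R :=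
  \prod_(x <- h | x.1 == q) G x.2.

Section Supermartingale.
Variables (q : spath E s r) (G : R -> R).
Hypothesis mG : measurable_fun setT G.
Hypothesis G0 : forall c, 0 <= G c.

Lemma stake_ge0 h : 0 <= stake q G h.
Proof. by rewrite prodr_ge0. Qed.

Lemma stake_rcons h x :
  stake q G (rcons h x) = if x.1 == q then stake q G h * G x.2 else stake q G h.
Proof.
by rewrite /stake -cats1 big_cat/= big_cons big_nil; case: ifP; rewrite mulr1.
Qed.

Let chosen n : set Omega := [set w | pi (run W pi w n) = q].

(** Only the last factor involves the fresh costs; everything else is determined by the first [n]
    observations. *)
Let stakeS n w : stake q G (run W pi w n.+1) =
  stake q G (run W pi w n) * \1_(~` chosen n) w +
  stake q G (run W pi w n) * \1_(chosen n) w * G (path_cost W n.+1 q w).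
Proof.
rewrite [run _ _ _ _]/= stake_rcons/=; case: eqP => piq.
  have -> : \1_(chosen n) w = 1 :> R by rewrite indicE mem_set.
  have -> : \1_(~` chosen n) w = 0 :> R by rewrite indicE memNset//; apply.
  by rewrite mulr0 add0r mulr1 piq.
have -> : \1_(chosen n) w = 0 :> R by rewrite indicE memNset.
have -> : \1_(~` chosen n) w = 1 :> R by rewrite indicE mem_set.
by rewrite mulr0 mul0r addr0 mulr1.
Qed.

Lemma measurable_stake n :
  measurable_fun setT (fun w : past W n => stake q G (run W pi w n)).
Proof.
elim: n => [|n IH].
  rewrite (_ : (fun _ => _) = cst 1); first exact: measurable_cst.
  by apply/funext => w; rewrite /stake big_nil.
under eq_fun do rewrite stakeS.
have mC := @measurable_choice n q.
apply: measurable_funD.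
  apply: measurable_fun_pastS; apply: measurable_funM => //.
  by apply: measurable_indic; exact: measurableC.
apply: measurable_funM.
  apply: measurable_fun_pastS; apply: measurable_funM => //.
by apply: measurableT_comp mG _; apply: measurable_past_cost; rewrite ltnSn.
Qed.

(** The supermartingale property in integrated form: where [q] is chosen, the stake is multiplied by
    an independent factor of mean at most 1; elsewhere it does not move. *)
Lemma integral_stake_le1 n :
  (forall t, (\int[P]_w (G (path_cost W t.+1 q w))%:E <= 1)%E) ->
  (\int[P]_w (stake q G (run W pi w n))%:E <= 1)%E.
Proof.
move=> G1; elim: n => [|n IH].
  under eq_integral do rewrite /stake big_nil.
  by rewrite integral_cst//= probability_setT mule1.
apply: le_trans IH; have mC := @measurable_choice n q.
have mS : measurable_fun setT (fun w : past W n => stake q G (run W pi w n)) :=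
  measurable_stake (n := n).
have mSC : measurable_fun setT
    (fun w : past W n => stake q G (run W pi w n) * \1_(chosen n) w).
  by apply: measurable_funM => //; apply: measurable_indic; exact: mC.
have mSN : measurable_fun setT
    (fun w : past W n => stake q G (run W pi w n) * \1_(~` chosen n) w).
  by apply: measurable_funM => //; apply: measurable_indic; exact: measurableC.
have mc := measurable_path_cost n.+1 q.
under eq_integral do rewrite stakeS EFinD [X in (_ + X)%E]EFinM.
rewrite ge0_integralD//=; last 4 first.
- by move=> w _; rewrite lee_fin mulr_ge0 ?stake_ge0.
- by apply/measurable_EFinP; exact: measurable_fun_past mSN.
- by move=> w _; rewrite -EFinM lee_fin !mulr_ge0 ?stake_ge0.
- apply/measurable_EFinP; apply: measurable_funM.
    exact: measurable_fun_past mSC.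
  exact: measurableT_comp mG mc.
rewrite (ge0_integralM_past Windep
  (F := fun w => (stake q G (run W pi w n) * \1_(chosen n) w)%:E)
  (g := fun x => (G (tuple_cost q x))%:E)); last 4 first.
- exact/measurable_EFinP.
- by move=> w; rewrite lee_fin mulr_ge0 ?stake_ge0.
- apply/measurable_EFinP; apply: measurableT_comp mG _.
  exact: measurable_tuple_cost.
- by move=> x; rewrite lee_fin.
(* Bounding the mean of the fresh factor by 1 leaves the old stake restricted to two complementary
   events. *)
apply: (@le_trans _ _
  (\int[P]_w (stake q G (run W pi w n) * \1_(~` chosen n) w)%:E +
   \int[P]_w (stake q G (run W pi w n) * \1_(chosen n) w)%:E)%E).
  rewrite leeD2l// -[leRHS]mule1 lee_wpmul2l ?G1//.
  by apply: integral_ge0 => w _; rewrite lee_fin mulr_ge0 ?stake_ge0.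
rewrite -ge0_integralD//=; last 4 first.
- by move=> w _; rewrite lee_fin mulr_ge0 ?stake_ge0.
- by apply/measurable_EFinP; exact: measurable_fun_past mSN.
- by move=> w _; rewrite lee_fin mulr_ge0 ?stake_ge0.
- by apply/measurable_EFinP; exact: measurable_fun_past mSC.
rewrite le_eqVlt; apply/orP; left; apply/eqP/eq_integral => w _.
rewrite -EFinD -mulrDr !indicE in_setC.
by case: (_ \in _); rewrite ?add0r ?addr0 mulr1.
Qed.

End Supermartingale.

End Play.

(** * Exponential moments *)

Section ExponentialMoments.
Context (d : measure_display) (Omega : measurableType d) (R : realType)
  (P : probability Omega R).

(** Both signs start from [expR x - 1 <= x * expR x], the tangent inequality at [- x], and bound
    [x * (expR x - 1)] again: by [x ^+ 2 * expR x] if [x] is nonnegative, by [x ^+ 2] otherwise. *)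
Lemma expR_le_quadratic (x : R) : expR x <= 1 + x + x ^+ 2 * expR `|x|.
Proof.
have e1 : expR x - 1 <= x * expR x.
  have := expR_ge1Dx (- x); rewrite expRN => h.
  have e0 := expR_gt0 x.
  have : (1 - x) * expR x <= 1.
    by rewrite -ler_pdivlMr// mul1r.
  lra.
have [x0|x0] := leP 0 x.
  rewrite ger0_norm//.
  have := ler_wpM2l x0 e1; nra.
have h1 := expR_ge1Dx x.
have h2 : x * (expR x - 1) <= x ^+ 2 by nra.
have h3 : x ^+ 2 <= x ^+ 2 * expR `|x|.
  by rewrite ler_peMr ?sqr_ge0// -expR0 ler_expR.
lra.
Qed.

Lemma expR_ge_sqr (y : R) : 0 <= y -> y ^+ 2 <= expR (2 * y).
Proof.
move=> y0; have -> : 2 * y = y + y by ring.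
rewrite expRD expr2; have := expR_ge1Dx y; have := expR_gt0 y; nra.
Qed.

Lemma integrable_exp_moment (X : Omega -> R) (v : R) :
  measurable_fun setT X -> 0 < v ->
  (\int[P]_w (expR (v * `|X w|))%:E < +oo)%E ->
  P.-integrable setT (EFin \o X).
Proof.
move=> mX v0 Xoo.
have mE : measurable_fun setT (fun w => expR (v * `|X w|)).
  by apply: measurableT_comp => //; apply: measurable_funM => //; exact: measurableT_comp.
have iE : P.-integrable setT (fun w => (v^-1 * expR (v * `|X w|))%:E).
  apply: (@integrableZl _ _ _ P setT measurableT v^-1
    (fun w => (expR (v * `|X w|))%:E)).
  apply/integrableP; split; first exact/measurable_EFinP.
  by under eq_integral do rewrite gee0_abs ?lee_fin ?expR_ge0//.
apply: (le_integrable measurableT _ _ iE); first exact/measurable_EFinP.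
move=> w _; rewrite /= lee_fin [leRHS]ger0_norm; last first.
  by rewrite mulr_ge0 ?invr_ge0 ?expR_ge0// ltW.
rewrite -ler_pdivrMl ?invr_gt0// invrK.
by apply: le_trans (expR_ge1Dx _); rewrite lerDr.
Qed.

(** In the quadratic bound on the exponential the linear term has mean zero, so the centred moment
    is at most [expR (u ^+ 2 * L)]. For small [u] this is absorbed by half of [u * delta]; [kappa]
    is the other half. The sign [e] selects the upper or lower tail, with the same [u] and
    [kappa]. *)
Lemma chernoff_tilt (X : Omega -> R) (theta v delta : R) :
  measurable_fun setT X -> 0 < v ->
  (\int[P]_w (expR (v * `|X w|))%:E < +oo)%E ->
  (\int[P]_w (X w)%:E = theta%:E)%E -> 0 < delta ->
  exists2 u : R, 0 < u & exists2 kappa : R, 0 < kappa &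
    forall e : R, `|e| = 1 ->
    (\int[P]_w (expR (u * (e * (X w - theta)) - u * delta + kappa))%:E <= 1)%E.
Proof.
move=> mX v0 Xoo EX delta0.
have iX := integrable_exp_moment mX v0 Xoo.
have mE : measurable_fun setT (fun w => expR (v * `|X w|)).
  by apply: measurableT_comp => //; apply: measurable_funM => //; exact: measurableT_comp.
have iE : P.-integrable setT (fun w => (expR (v * `|X w|))%:E).
  apply/integrableP; split; first exact/measurable_EFinP.
  by under eq_integral do rewrite gee0_abs ?lee_fin ?expR_ge0//.
pose m := fine (\int[P]_w (expR (v * `|X w|))%:E)%E.
have mP : (\int[P]_w (expR (v * `|X w|))%:E = m%:E)%E.
  by rewrite fineK// integrable_fin_num.
have m0 : 0 <= m.
  by rewrite /m fine_ge0//; apply: integral_ge0 => w _; rewrite lee_fin expR_ge0.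
pose v' := v / 3.
have v'0 : 0 < v' by rewrite divr_gt0.
(* The factor [v' ^- 2] comes from bounding the square by an exponential, the other from replacing
   [X - theta] by [X]. *)
pose K := v' ^- 2 * expR (v * `|theta|).
have K0 : 0 <= K by rewrite mulr_ge0 ?expR_ge0// invr_ge0 sqr_ge0.
pose L := K * m + 1.
have L0 : 0 < L by rewrite ltr_wpDl// mulr_ge0.
(* The first bound keeps the exponential moment finite; the second gives
   [u ^+ 2 * L <= u * delta / 2]. *)
pose u := Num.min v' (delta / (2 * L)).
have u0 : 0 < u by rewrite lt_min v'0 divr_gt0// mulr_gt0.
exists u => //; exists (u * delta / 2); first by rewrite divr_gt0// mulr_gt0.
move=> e e1.
have bnd w : expR (u * (e * (X w - theta))) <=
    1 + u * e * (X w - theta) + u ^+ 2 * K * expR (v * `|X w|).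
  set Z := e * (X w - theta).
  have nZ : `|Z| = `|X w - theta| by rewrite normrM e1 mul1r.
  have uv' : u <= v' by rewrite ge_min lexx.
  have s1 : v' ^+ 2 * Z ^+ 2 <= expR (2 * (v' * `|Z|)).
    have -> : v' ^+ 2 * Z ^+ 2 = (v' * `|Z|) ^+ 2.
      by rewrite [RHS]exprMn real_normK ?num_real.
    by apply: expR_ge_sqr; rewrite mulr_ge0// ltW.
  have s2 : v' ^+ 2 * Z ^+ 2 * expR (u * `|Z|) <=
      expR (v * `|theta|) * expR (v * `|X w|).
    apply: (@le_trans _ _ (expR (2 * (v' * `|Z|)) * expR (v' * `|Z|))).
      apply: ler_pM s1 _; rewrite ?ler_expR ?ler_wpM2r ?expR_ge0//.
      by rewrite mulr_ge0 ?sqr_ge0.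
    rewrite -!expRD ler_expR.
    have -> : 2 * (v' * `|Z|) + v' * `|Z| = v * `|Z| by rewrite /v'; field.
    rewrite -mulrDr ler_pM2l// nZ [leRHS]addrC; exact: ler_normB.
  apply: (le_trans (expR_le_quadratic _)).
  rewrite -(mulrA u e) -/Z lerD2l (exprMn _ u) -!(mulrA (u ^+ 2)).
  rewrite normrM (gtr0_norm u0) ler_wpM2l ?sqr_ge0//.
  by rewrite /K -(mulrA (v' ^- 2)) ler_pdivlMl ?exprn_gt0// mulrA.
have mZ : measurable_fun setT (fun w => u * (e * (X w - theta))).
  by do 2 (apply: measurable_funM => //); exact: measurable_funB.
have step1 : (\int[P]_w (expR (u * (e * (X w - theta))))%:E <= (1 + u ^+ 2 * K * m)%:E)%E.
  apply: (@le_trans _ _ (\int[P]_w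
     ((1 - u * e * theta)%:E + ((u * e)%:E * (X w)%:E +
        (u ^+ 2 * K)%:E * (expR (v * `|X w|))%:E)))%E).
    apply: ge0_le_integral => //.
    - by apply/measurable_EFinP; exact: measurableT_comp.
    - apply: emeasurable_funD => //; apply: emeasurable_funD.
        by apply: measurable_funeM; exact/measurable_EFinP.
      by apply: measurable_funeM; exact/measurable_EFinP.
    - move=> w _; rewrite -!EFinM -!EFinD lee_fin; have := bnd w; lra.
  have i1 : P.-integrable setT (fun w => (u * e)%:E * (X w)%:E)%E by exact: integrableZl.
  have i2 : P.-integrable setT (fun w => (u ^+ 2 * K)%:E * (expR (v * `|X w|))%:E)%E.
    exact: integrableZl.
  rewrite integralD//=; last 2 first.
  - exact: finite_measure_integrable_cst.
  - exact: integrableD.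
  rewrite integralD//= !integralZl//= EX mP integral_cst//= probability_setT mule1.
  rewrite -!EFinM -!EFinD lee_fin; lra.
apply: (@le_trans _ _ ((expR (- (u * delta / 2)))%:E *
    \int[P]_w (expR (u * (e * (X w - theta))))%:E)%E).
  rewrite -ge0_integralZl//=; last first.
    by apply/measurable_EFinP; exact: measurableT_comp.
  rewrite le_eqVlt; apply/orP; left; apply/eqP/eq_integral => w _.
  rewrite -EFinM -expRD; congr (expR _)%:E; lra.
apply: (@le_trans _ _ ((expR (- (u * delta / 2)))%:E * (1 + u ^+ 2 * K * m)%:E)%E).
  by rewrite lee_wpmul2l// lee_fin expR_ge0.
rewrite -EFinM lee_fin.
apply: (@le_trans _ _ (expR (- (u * delta / 2)) * expR (u ^+ 2 * L))).
  rewrite ler_wpM2l ?expR_ge0//; apply: le_trans (expR_ge1Dx _).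
  by rewrite lerD2l -mulrA ler_wpM2l ?sqr_ge0// /L lerDl.
rewrite -expRD expR_le1.
have uL : u * (2 * L) <= delta.
  by rewrite -ler_pdivlMr ?mulr_gt0// ge_min lexx orbT.
have : u * (u * (2 * L)) <= u * delta by rewrite ler_pM2l.
lra.
Qed.

End ExponentialMoments.

(** The witness is the minimum of the individual thresholds and 1, which stays positive even over an
    empty index type. It serves for edges, paths and spanner elements alike. *)
Lemma finite_common_threshold (R : realType) (I : finType) (Q : I -> R -> Prop) :
  (forall i x y, 0 < y -> y <= x -> Q i x -> Q i y) ->
  (forall i, exists2 x, 0 < x & Q i x) ->
  exists2 x, 0 < x & forall i, Q i x.
Proof.
move=> Qle Qex.
have /choice [g gP] : forall i, exists x, 0 < x /\ Q i x.
  by move=> i; have [x x0 Qx] := Qex i; exists x.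
have m0 : 0 < \big[Num.min/1]_i g i by apply: lt_bigmin => // i _; case: (gP i).
exists (\big[Num.min/1]_i g i) => // i.
by apply: (Qle i (g i)) (gP i).2 => //; exact: bigmin_le_cond.
Qed.

(** * Exponential moments common to all paths and times *)

Section IdenticalCosts.
Context (V : finType) (E : {set V * V}) (s r : V) (R : realType)
  (dO : measure_display) (Omega : measurableType dO) (P : probability Omega R)
  (W : nat -> {RV P >-> #|E|.-tuple R}).
Hypothesis Wident : identically_distributed_seq W.
Hypothesis Wlight : forall (t : nat) (j : 'I_#|E|), (0 < t)%N ->
  light_tailed P (fun w => tnth (W t w) j).

Lemma ge0_integral_ident (f : #|E|.-tuple R -> \bar R) t u :
  (0 < t)%N -> (0 < u)%N -> measurable_fun setT f -> (forall x, (0 <= f x)%E) ->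
  (\int[P]_w f (W t w) = \int[P]_w f (W u w))%E.
Proof.
move=> t0 u0 mf f0.
transitivity (\int[distribution P (W t)]_x f x)%E.
  by rewrite ge0_integral_distribution.
transitivity (\int[distribution P (W u)]_x f x)%E.
  by apply: eq_measure_integral => A mA _; exact: Wident.
by rewrite ge0_integral_distribution.
Qed.

(** The edge of largest absolute cost dominates: the path cost is at most [#|E|] times it, and its
    exponential is bounded by one summand. A sum over edges asks only for moments of single edges.
    The leading 1 and the successor in [#|E|.+1] also cover an empty edge set. *)
Lemma tuple_cost_exp_bound (p : spath E s r) (x : #|E|.-tuple R) (u : R) :
  0 <= u ->
  expR (u / (#|E|.+1)%:R * `|tuple_cost p x|) <=
  1 + \sum_j (expR (u * tnth x j) + expR (- u * tnth x j)).
Proof.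
move=> u0.
have pos j : 0 <= expR (u * tnth x j) + expR (- u * tnth x j).
  by rewrite addr_ge0 ?expR_ge0.
have [j0|noedge] := pickP (xpredT : pred 'I_#|E|); last first.
  rewrite /tuple_cost big1; last by move=> j; have := noedge j.
  by rewrite normr0 mulr0 expR0 lerDl sumr_ge0.
move=> _.
have [k _ kmax] := @Order.TotalTheory.arg_maxP _ _ _ j0 xpredT
  (fun j => `|tnth x j|) isT.
have cost_le : `|tuple_cost p x| <= (#|E|.+1)%:R * `|tnth x k|.
  apply: (le_trans (ler_norm_sum _ _ _)).
  apply: (@le_trans _ _ (\sum_(j < #|E|) `|tnth x k|)).
    rewrite big_mkcond; apply: ler_sum => j _.
    by case: ifP => // _; exact: kmax.
  rewrite sumr_const card_ord -[leLHS]mulr_natl ler_wpM2r//.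
  by rewrite ler_nat.
apply: (@le_trans _ _ (expR (u * `|tnth x k|))).
  rewrite ler_expR -mulrA ler_wpM2l// ler_pdivrMl//.
rewrite (bigD1 k)//= ; have : expR (u * `|tnth x k|) <=
    expR (u * tnth x k) + expR (- u * tnth x k).
  have [h|h] := leP 0 (tnth x k).
    by rewrite ger0_norm// lerDl expR_ge0.
  by rewrite ltr0_norm// mulrN mulNr lerDr expR_ge0.
have : 0 <= \sum_(i < #|E| | i != k) (expR (u * tnth x i) + expR (- u * tnth x i)).
  by apply: sumr_ge0.
lra.
Qed.

Lemma path_cost_exp_moment : exists2 v : R, 0 < v &
  forall t (p : spath E s r), (0 < t)%N ->
  (\int[P]_w (expR (v * `|path_cost W t p w|))%:E < +oo)%E.
Proof.
(* One range of exponents for all edges at time 1; identical distribution carries the resulting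
   bound to the other times. *)
have [u u0 uM] : exists2 u : R, 0 < u & forall (j : 'I_#|E|) c, `|c| <= u ->
    ('M_P (fun w => tnth (W 1 w) j) c < +oo)%E.
  apply: (finite_common_threshold (Q := fun j u => forall c, `|c| <= u ->
    ('M_P (fun w => tnth (W 1 w) j) c < +oo)%E)) => [j x y _ yx Qx c cy|j].
    by apply: Qx; exact: le_trans yx.
  exact: Wlight.
have {}uM j c : `|c| <= u -> (\int[P]_w (expR (c * tnth (W 1 w) j))%:E < +oo)%E.
  move=> /(uM j); rewrite /mmt_gen_fun unlock.
  by under eq_integral do rewrite /= mulrC.
pose dom (x : #|E|.-tuple R) : R :=
  1 + \sum_j (expR (u * tnth x j) + expR (- u * tnth x j)).
exists (u / (#|E|.+1)%:R); first by rewrite divr_gt0.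
move=> t p t0.
pose F (x : #|E|.-tuple R) : \bar R := (expR (u / (#|E|.+1)%:R * `|tuple_cost p x|))%:E.
have mF : measurable_fun setT F.
  apply/measurable_EFinP; apply: measurableT_comp => //.
  apply: measurable_funM => //; apply: measurableT_comp => //.
  exact: measurable_tuple_cost.
have mtn j (c : R) : measurable_fun setT (fun x : #|E|.-tuple R => expR (c * tnth x j)).
  apply: measurableT_comp => //; apply: measurable_funM => //.
  exact: measurable_tnth.
have mdom : measurable_fun setT (fun w => dom (W 1 w)).
  apply: measurable_funD => //; apply: measurable_sum => j.
  by apply: measurable_funD;
    exact: (measurableT_comp (mtn _ _) (measurable_funPT (W 1))).
rewrite -[X in (X < _)%E]/(\int[P]_w F (W t w))%E.
rewrite (@ge0_integral_ident _ t 1%N)//; last by move=> x; rewrite lee_fin expR_ge0.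
apply: (@le_lt_trans _ _ (\int[P]_w (dom (W 1 w))%:E)%E).
  apply: ge0_le_integral => //.
  - by move=> w _; rewrite lee_fin expR_ge0.
  - exact: (measurableT_comp mF (measurable_funPT (W 1))).

  - exact/measurable_EFinP/mdom.
  - by move=> w _; rewrite lee_fin; apply: tuple_cost_exp_bound; exact: ltW.
have ij j c : `|c| <= u ->
    P.-integrable setT (fun w => (expR (c * tnth (W 1 w) j))%:E).
  move=> cu; apply/integrableP; split.
    by apply/measurable_EFinP; exact: (measurableT_comp (mtn _ _) (measurable_funPT (W 1))).
  under eq_integral do rewrite gee0_abs ?lee_fin ?expR_ge0//.
  exact: uM.
have idom : P.-integrable setT (fun w => (dom (W 1 w))%:E).
  rewrite (_ : (fun _ => _) = (fun w => 1%:E + \sum_j ((expR (u * tnth (W 1 w) j))%:E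
      + (expR (- u * tnth (W 1 w) j))%:E))%E); last first.
    by apply/funext => w; rewrite /dom EFinD sumEFin.
  apply: integrableD => //; first exact: finite_measure_integrable_cst.
  apply: integrable_sum => // j _.
  by apply: integrableD => //; apply: ij; rewrite ?normrN gtr0_norm.
by have := integrable_lty measurableT idom.
Qed.

End IdenticalCosts.

(** * Exploration times *)

Section ExplorationCount.
Context (R : realType) (d : nat) (f : nat -> R).

Lemma explore_le t x : x \in explore d f t -> (x <= t)%N.
Proof.
elim: t => [|t IH]/=; first by rewrite in_fset0.
case: ifP => _; last by move=> /IH /leqW.
by rewrite in_fset1U => /orP[/eqP ->//|/IH /leqW].
Qed.

Lemma explore_notin t : t.+1 \notin explore d f t.
Proof. by apply/negP => /explore_le; rewrite ltnn. Qed.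

Lemma mem_exploreS t : (t.+1 \in explore d f t.+1) =
  (t == 0%N) || (#|` explore d f t|%:Z < d%:Z * Num.ceil (f t.+1 * ln t.+1%:R)).
Proof.
by rewrite /=; case: ifP => _; rewrite ?in_fset1U ?eqxx// (negbTE (explore_notin t)).
Qed.

Lemma card_exploreS t : #|` explore d f t.+1| =
  (#|` explore d f t| + (t.+1 \in explore d f t.+1))%N.
Proof.
rewrite mem_exploreS/=; case: ifP => _; last by rewrite addn0.
by rewrite cardfsU1 explore_notin addnC.
Qed.

Hypothesis f_pos : forall t, (0 < t)%N -> 0 < f t.
Hypothesis f_incr : forall t u, (0 < t)%N -> (t <= u)%N -> f t <= f u.

(** A time joins only while the count is below the quota, so the leading 1 pays for the last one
    that joined, time 1 included; the inner 1 pays for the ceiling. At the other times the bound can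
    only grow. *)
Lemma card_explore_le t : (0 < t)%N ->
  (#|` explore d f t|)%:R <= 1 + d%:R * (f t * ln t%:R + 1) :> R.
Proof.
have bnd0 u : (0 < u)%N -> 0 <= f u * ln u%:R.
  by move=> u0; rewrite mulr_ge0 ?ln_ge0 ?ler1n// ltW ?f_pos.
elim: t => // t IH _; rewrite card_exploreS natrD mem_exploreS.
case: t => [|t] in IH *.
  by rewrite cardfs0 add0r lerDl mulr_ge0// addr_ge0// bnd0.
rewrite orFb; case: ltP => [|_]; last first.
  rewrite addr0; apply: (le_trans (IH isT)).
  rewrite lerD2l ler_wpM2l// lerD2r ler_pM ?ln_ge0 ?ler1n ?f_incr//.
    by rewrite ltW ?f_pos.
  by rewrite ler_ln ?posrE ?ltr0n// ler_nat.
set c := Num.ceil _ => /ltW; rewrite -(ler_int R) intrM => cle.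
have := ceilB1_lt (f t.+2 * ln t.+2%:R); rewrite -/c intrD => cub.
rewrite addrC lerD2l; apply: (le_trans cle).
by rewrite ler_wpM2l// -lerBlDr ltW.
Qed.

(** Not exploring means that the quota is filled. The quota is a multiple of [d], so [k], the
    ceiling, counts full rounds through the spanner. *)
Lemma card_explore_ge t : t.+1 \notin explore d f t.+1 ->
  exists2 k, f t.+1 * ln t.+1%:R <= k%:R & (k * d <= #|` explore d f t|)%N.
Proof.
rewrite mem_exploreS negb_or -leNgt => /andP[t0].
set x := f _ * _ => le_card.
have x0 : 0 <= x by rewrite mulr_ge0 ?ln_ge0 ?ler1n// ltW ?f_pos.
have c0 : 0 <= Num.ceil x by rewrite ceil_ge0// (lt_le_trans _ x0)// ltrN10.
exists `|Num.ceil x|%N.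
  by rewrite natr_absz ger0_norm// ceil_ge.
by rewrite -lez_nat PoszM gez0_abs// mulrC.
Qed.

End ExplorationCount.

(** The numbers [l * d + i] with [l < k] are distinct, below [N], and have residue [i]. *)
Lemma count_mod_ge (d : nat) (i k N : nat) : (i < d)%N -> (k * d <= N)%N ->
  (k <= count (fun c => c %% d == i) (iota 0 N))%N.
Proof.
move=> id kN; rewrite -size_filter -[leqLHS](size_iota 0 k).
rewrite -(size_map (fun l => l * d + i)%N).
apply: uniq_leq_size.
  rewrite map_inj_uniq ?iota_uniq// => l m /addIn/eqP.
  by rewrite eqn_pmul2r ?(leq_ltn_trans _ id)// => /eqP.
move=> _ /mapP[l lk ->]; rewrite mem_filter modnMDl modn_small// eqxx/=.
move: lk; rewrite !mem_iota !add0n/= => lk; apply: leq_trans kN.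
by rewrite (leq_trans _ (leq_mul lk (leqnn d)))// mulSn addnC ltn_add2r.
Qed.

Section RoundRobin.
Context (V : finType) (E : {set V * V}) (s r : V) (R : realType)
  (B : 'I_(path_dim E s r R) -> spath E s r)
  (a : spath E s r -> 'I_(path_dim E s r R) -> R) (f : nat -> R)
  (pi : history E s r R -> spath E s r).
Hypothesis pi_asr : is_asr_policy B a f pi.
Context (dO : measure_display) (Omega : measurableType dO) (P : probability Omega R)
  (W : nat -> {RV P >-> #|E|.-tuple R}).
Let d := path_dim E s r R.

(** Time 1 is an exploration time, so the policy has to name an element of the spanner there. *)
Lemma path_dim_gt0 : (0 < d)%N.
Proof.
have := pi_asr [::]; rewrite /asr_choice/= in_fset1U eqxx/= => -[i _ _].
by rewrite (leq_ltn_trans _ (ltn_ord i)).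
Qed.

(** Explorations visit the spanner cyclically, so residues modulo [d] count the exploratory
    observations of [B i]; observations made while exploiting only add to them. *)
Lemma count_obs_ge w n k (i : 'I_d) : (k * d <= #|` explore d f n|)%N ->
  (k <= size [seq x <- run W pi w n | x.1 == B i])%N.
Proof.
move=> kd; rewrite size_filter.
apply: (leq_trans (count_mod_ge (ltn_ord i) kd)).
elim: n {k kd} => [//|n IH]; rewrite card_exploreS.
case: (boolP (n.+1 \in _)) => [joined|_]; last first.
  by rewrite addn0/= -cats1 count_cat (leq_trans IH)// leq_addr.
(* The exploration that follows [c] earlier ones has rank [c.+1], and [oslash] sends this rank to
   [(c %% d).+1], matching residues counted from 0. *)
rewrite addn1 -addn1 iotaD count_cat/= -cats1 count_cat leq_add//= !addn0 add0n.
have := pi_asr (run W pi w n); rewrite /asr_choice size_run joined.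
rewrite card_exploreS joined addn1 /oslash subn1/= => -[j [ji] ->].
by case: eqP => // ij; rewrite (_ : j = i) ?eqxx//; apply/val_inj; rewrite /= ji.
Qed.

End RoundRobin.

(** * Regret and its bound *)

Section MeanCosts.
Context (V : finType) (E : {set V * V}) (s r : V) (R : realType)
  (dO : measure_display) (Omega : measurableType dO) (P : probability Omega R)
  (W : nat -> {RV P >-> #|E|.-tuple R}).
Hypothesis Wident : identically_distributed_seq W.
Hypothesis Wlight : forall (t : nat) (j : 'I_#|E|), (0 < t)%N ->
  light_tailed P (fun w => tnth (W t w) j).

Lemma integrable_path_cost t (p : spath E s r) : (0 < t)%N ->
  P.-integrable setT (EFin \o path_cost W t p).
Proof.
move=> t0; have [v v0 vM] := path_cost_exp_moment s r Wident Wlight.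
by apply: (integrable_exp_moment _ v0); [exact: measurable_path_cost|exact: vM].
Qed.

Definition mean_cost (p : spath E s r) : R :=
  fine (\int[P]_w (path_cost W 1 p w)%:E).

Lemma integral_path_cost t (p : spath E s r) : (0 < t)%N ->
  (\int[P]_w (path_cost W t p w)%:E = (mean_cost p)%:E)%E.
Proof.
move=> t0; rewrite /mean_cost fineK; last first.
  by apply: integrable_fin_num => //; exact: integrable_path_cost.
have mc : measurable_fun setT (EFin \o @tuple_cost V E s r R p).
  by apply/measurable_EFinP; exact: measurable_tuple_cost.
transitivity (\int[distribution P (W t)]_x (tuple_cost p x)%:E)%E.
  by rewrite integral_distribution//; exact: integrable_path_cost.
transitivity (\int[distribution P (W 1)]_x (tuple_cost p x)%:E)%E.
  by apply: eq_measure_integral => A mA _; exact: Wident.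
by rewrite integral_distribution//; exact: integrable_path_cost.
Qed.

(** A path cost is the dot product of the incidence vector with the edge costs, hence linear in the
    vector: the decomposition holds pointwise, then in expectation. *)
Lemma mean_cost_spanner (B : 'I_(path_dim E s r R) -> spath E s r) a p :
  spanner_coefs B a -> mean_cost p = \sum_i a p i * mean_cost (B i).
Proof.
move=> /(_ p)[_ pE].
have costE w : path_cost W 1 p w = \sum_i a p i * path_cost W 1 (B i) w.
  have dot q : path_cost W 1 q w = \sum_j pvec R q 0 j * tnth (W 1 w) j.
    rewrite /path_cost big_mkcond; apply: eq_bigr => j _.
    by rewrite mxE; case: ifP; rewrite ?mul1r ?mul0r.
  rewrite dot pE; under eq_bigr do rewrite summxE mulr_suml.
  rewrite exchange_big; apply: eq_bigr => i _; rewrite dot mulr_sumr.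
  by apply: eq_bigr => j _; rewrite mxE mulrA.
apply: EFin_inj; rewrite -(@integral_path_cost 1%N)//.
under eq_integral do rewrite costE -sumEFin.
rewrite integral_sum//; last first.
  move=> i; apply: (@integrableZl _ _ _ P setT measurableT (a p i)
    (EFin \o path_cost W 1 (B i))).
  exact: integrable_path_cost.
rewrite -sumEFin; apply: eq_bigr => i _; under eq_integral do rewrite EFinM.
by rewrite integralZl ?integral_path_cost//; exact: integrable_path_cost.
Qed.

Lemma mean_cost_min (q p : spath E s r) : min_expected_cost W q ->
  mean_cost q <= mean_cost p.
Proof.
move=> /(_ 1%N isT p); by rewrite unlock !integral_path_cost.
Qed.

Variable pi : history E s r R -> spath E s r.
Hypothesis pi_meas : measurable_policy pi.
Hypothesis Windep : independent_seq W.

Definition choice_prob (n : nat) (p : spath E s r) : R :=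
  fine (P [set w | pi (run W pi w n) = p]).

Lemma measurable_choice_event n p : measurable [set w | pi (run W pi w n) = p].
Proof.
apply: (@measurable_past _ _ _ _ _ _ W n [set w | pi (run W pi w n) = p]).
exact: measurable_choice.
Qed.

Lemma choice_probE n p : (choice_prob n p)%:E = P [set w | pi (run W pi w n) = p].
Proof.
by rewrite fineK// fin_num_measure//; exact: measurable_choice_event.
Qed.

Lemma choice_prob_ge0 n p : 0 <= choice_prob n p.
Proof. by rewrite -lee_fin choice_probE. Qed.

Lemma choice_prob_le1 n p : choice_prob n p <= 1.
Proof.
by rewrite -lee_fin choice_probE probability_le1//; exact: measurable_choice_event.
Qed.

(** The usual decomposition by gaps: the choice at time [t] is determined by the past, so it is
    independent of the costs at time [t], and each path contributes its probability times its
    gap. *)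
Lemma regretE (sigma : spath E s r) T : regret W pi sigma T =
  (\sum_(1 <= t < T.+1) \sum_p choice_prob t.-1 p * (mean_cost p - mean_cost sigma))%:E.
Proof.
(* For each [w] exactly one [p] has a nonzero indicator, so these terms sum to the loss at time
   [t]. *)
pose term t p w := \1_[set w | pi (run W pi w t.-1) = p] w *
  (path_cost W t p w - path_cost W t sigma w).
have iB t (p : spath E s r) : (0 < t)%N -> P.-integrable setT
    (fun w => (path_cost W t p w - path_cost W t sigma w)%:E).
  move=> t0; apply: (@integrableB _ _ _ P setT measurableT
    (EFin \o path_cost W t p) (EFin \o path_cost W t sigma)).
    exact: integrable_path_cost.
  exact: integrable_path_cost.
have iT t p : (0 < t)%N -> P.-integrable setT (EFin \o term t p).
  move=> t0; apply: (le_integrable measurableT _ _ (iB t p t0)).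
    apply/measurable_EFinP/measurable_funM.
      by apply: measurable_indic; exact: measurable_choice_event.
    by apply: measurable_funB; exact: measurable_path_cost.
  move=> w _; rewrite /= lee_fin /term normrM indicE.
  by case: (_ \in _); rewrite ?normr1 ?mul1r ?normr0 ?mul0r.
have Eterm t p : (0 < t)%N -> (\int[P]_w (term t p w)%:E =
    (choice_prob t.-1 p * (mean_cost p - mean_cost sigma))%:E)%E.
  case: t => // t _; rewrite /term/=.
  rewrite (integral_indicM_past Windep
    (A := [set w : past W t | pi (run W pi w t) = p])
    (g := fun x => tuple_cost p x - tuple_cost sigma x)); last 3 first.
  - exact: measurable_choice.
  - by apply: measurable_funB; exact: measurable_tuple_cost.
  - exact: (iB t.+1 p isT).
  rewrite EFinM choice_probE; congr (_ * _)%E.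
  under eq_integral do rewrite EFinB.
  rewrite integralB//=; last 2 first.
  - exact: (integrable_path_cost p (ltn0Sn t)).
  - exact: (integrable_path_cost sigma (ltn0Sn t)).
  by rewrite (integral_path_cost p (ltn0Sn t)) (integral_path_cost sigma (ltn0Sn t)).
have regret_term t w : (0 < t)%N ->
    policy_cost W pi t w - path_cost W t sigma w = \sum_p term t p w.
  move=> t0; rewrite (bigD1 (pi (run W pi w t.-1)))//= big1 ?addr0.
    by rewrite /term indicE mem_set//= mul1r.
  move=> p; rewrite eq_sym => /eqP pw.
  by rewrite /term indicE memNset ?mul0r.
have sum_term w : \sum_(1 <= t < T.+1) (policy_cost W pi t w - path_cost W t sigma w) =
    \sum_(0 <= t < T) \sum_p term t.+1 p w.
  by rewrite big_add1; apply: eq_bigr => t _; rewrite regret_term.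
rewrite /regret unlock big_add1/=.
under eq_integral do rewrite sum_term -sumEFin.
rewrite integral_sum//; last first.
  move=> t; under eq_fun do rewrite -sumEFin.
  by apply: integrable_sum => // p _; exact: iT.
rewrite -sumEFin; apply: eq_bigr => t _.
under eq_integral do rewrite -sumEFin.
rewrite integral_sum//; last by move=> p; exact: iT.
by rewrite -sumEFin; apply: eq_bigr => p _; rewrite Eterm.
Qed.

End MeanCosts.

(** * From inaccurate means to large stakes, and from accurate means to good choices *)

Section Concentration.
Context (V : finType) (E : {set V * V}) (s r : V) (R : realType).
Implicit Types (h : history E s r R) (q : spath E s r).

(** With [N] observations the exponents add up to [N * (u * (e * (mean - theta) - delta)) + kappa *
    N], where the first term is nonnegative and [N] is at least [k]. *)
Lemma stake_large h q (u kappa delta theta e : R) (k : nat) :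
  0 <= u -> 0 <= kappa ->
  (k <= size [seq x <- h | x.1 == q])%N ->
  delta <= e * (sample_mean h q - theta) ->
  expR (kappa * k%:R) <=
  stake q (fun c => expR (u * (e * (c - theta)) - u * delta + kappa)) h.
Proof.
move=> u0 kappa0 kN dev; rewrite /stake -expR_sum ler_expR.
set obs := [seq x <- h | x.1 == q] in kN *.
have -> : \sum_(x <- h | x.1 == q) (u * (e * (x.2 - theta)) - u * delta + kappa) =
    u * e * (\sum_(x <- obs) x.2) +
    (size obs)%:R * (- (u * e * theta) - u * delta + kappa).
  rewrite -big_filter -/obs.
  elim: obs {kN} => [|x l IH]; first by rewrite !big_nil mul0r mulr0 addr0.
  by rewrite !big_cons IH/= -[(size l).+1]addn1 natrD; ring.
(* Also true without observations, since then the sample mean is 0 / 0 = 0. *)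
have mE : \sum_(x <- obs) x.2 = (size obs)%:R * sample_mean h q.
  rewrite /sample_mean size_map -/obs big_map.
  have [->|obs0] := eqVneq obs [::]; first by rewrite big_nil mul0r.
  by rewrite mulrC divfK// pnatr_eq0 size_eq0.
have kN' : k%:R <= (size obs)%:R :> R by rewrite ler_nat.
rewrite mE.
have -> : u * e * ((size obs)%:R * sample_mean h q) +
    (size obs)%:R * (- (u * e * theta) - u * delta + kappa) =
    (size obs)%:R * (u * (e * (sample_mean h q - theta) - delta)) +
    kappa * (size obs)%:R by ring.
have : kappa * k%:R <= kappa * (size obs)%:R by rewrite ler_wpM2l.
have : 0 <= (size obs)%:R * (u * (e * (sample_mean h q - theta) - delta)).
  by rewrite !mulr_ge0// subr_ge0.
lra.
Qed.

(** Coefficients of size at most 1 put every path estimate within [d * delta] of its mean; comparing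
    two estimates doubles this error. *)
Lemma estimate_optimal (B : 'I_(path_dim E s r R) -> spath E s r) a
    (mu : spath E s r -> R) h p q (delta : R) :
  (forall p i, `|a p i| <= 1) ->
  (forall p, mu p = \sum_i a p i * mu (B i)) ->
  (forall i, `|sample_mean h (B i) - mu (B i)| <= delta) ->
  path_estimate B a h p <= path_estimate B a h q ->
  mu p - mu q <= 2 * ((path_dim E s r R)%:R * delta).
Proof.
move=> a1 muE close pq.
have est o : `|path_estimate B a h o - mu o| <= (path_dim E s r R)%:R * delta.
  rewrite muE /path_estimate -sumrB.
  apply: (le_trans (ler_norm_sum _ _ _)).
  apply: (@le_trans _ _ (\sum_(i < path_dim E s r R) delta)).
    apply: ler_sum => i _; rewrite -mulrBr normrM -[leRHS]mul1r.
    by apply: ler_pM.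
  by rewrite sumr_const card_ord mulr_natl.
have := est p; have := est q; rewrite !ler_norml => /andP[_ h1] /andP[h2 _].
lra.
Qed.

End Concentration.

(** * Probability of a suboptimal exploitation *)

Section ExploitationError.
Context (V : finType) (E : {set V * V}) (s r : V) (R : realType)
  (dO : measure_display) (Omega : measurableType dO) (P : probability Omega R)
  (W : nat -> {RV P >-> #|E|.-tuple R}).
Hypothesis Windep : independent_seq W.
Hypothesis Wident : identically_distributed_seq W.
Hypothesis Wlight : forall (t : nat) (j : 'I_#|E|), (0 < t)%N ->
  light_tailed P (fun w => tnth (W t w) j).
Context (B : 'I_(path_dim E s r R) -> spath E s r)
  (a : spath E s r -> 'I_(path_dim E s r R) -> R)
  (f : nat -> R) (pi : history E s r R -> spath E s r).
Hypothesis a_coefs : spanner_coefs B a.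
Hypothesis pi_meas : measurable_policy pi.
Hypothesis pi_asr : is_asr_policy B a f pi.
Variable sigma : spath E s r.
Local Notation d := (path_dim E s r R).
Local Notation theta := (mean_cost W).

(** Markov's inequality for the sum of [2 * d] stakes, one for each spanner path and sign: a
    suboptimal choice makes at least one of them reach [expR (kappa * k%:R)], while each has mean at
    most 1. *)
Lemma exploitation_error : exists2 kappa : R, 0 < kappa &
  forall n k p, n.+1 \notin explore d f n.+1 -> (k * d <= #|` explore d f n|)%N ->
  theta sigma < theta p ->
  choice_prob W pi n p <= 2 * d%:R * expR (- (kappa * k%:R)).
Proof.
(* An accuracy [delta] for the spanner means that separates every suboptimal path from [sigma]. *)
have [delta delta0 deltaP] : exists2 delta : R, 0 < delta & forall p : spath E s r,
    theta sigma < theta p -> 2 * (d%:R * delta) < theta p - theta sigma.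
  apply: (finite_common_threshold (I := spath E s r) (Q := fun p delta =>
    theta sigma < theta p -> 2 * (d%:R * delta) < theta p - theta sigma)).
    move=> p x y y0 yx Qx /Qx; apply: le_lt_trans.
    by rewrite ler_pM2l// ler_wpM2l.
  move=> p; have [gap|nogap] := ltP (theta sigma) (theta p); last by exists 1.
  (* Dividing by [d + 1] instead of [d] leaves the fraction [d / (d + 1)] of the gap, which is
     strictly smaller than the gap. *)
  exists ((theta p - theta sigma) / (2 * (d%:R + 1))).
    by rewrite divr_gt0 ?subr_gt0// mulr_gt0// ltr_wpDl.
  move=> _; have g0 : 0 < theta p - theta sigma by rewrite subr_gt0.
  have -> : 2 * (d%:R * ((theta p - theta sigma) / (2 * (d%:R + 1)))) =
      (theta p - theta sigma) * (d%:R / (d%:R + 1)).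
    by field; rewrite natr1 pnatr_eq0.
  have d1 : 0 < d%:R + 1 :> R by rewrite ltr_wpDl.
  by rewrite gtr_pMr// ltr_pdivrMr// mul1r ltrDl.
have [v v0 vM] := path_cost_exp_moment s r Wident Wlight.
have mtilt t i u e kap : measurable_fun setT (fun w =>
    (expR (u * (e * (path_cost W t (B i) w - theta (B i))) - u * delta + kap))%:E).
  apply/measurable_EFinP; apply: measurableT_comp => //.
  apply: measurable_funD => //; apply: measurable_funB => //.
  do 2 (apply: measurable_funM => //).
  by apply: measurable_funB => //; exact: measurable_path_cost.
(* Lowering [kappa] with [u] fixed lowers the integrand, so one [kappa] serves all spanner paths
   while [u] still depends on [i]. *)
have [kappa kappa0 kappaP] : exists2 kappa : R, 0 < kappa & forall i,
    exists2 u : R, 0 < u & forall e : R, `|e| = 1 -> forall t,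
    (\int[P]_w (expR (u * (e * (path_cost W t.+1 (B i) w - theta (B i))) -
       u * delta + kappa))%:E <= 1)%E.
  apply: (finite_common_threshold (Q := fun i kappa =>
    exists2 u : R, 0 < u & forall e : R, `|e| = 1 -> forall t,
    (\int[P]_w (expR (u * (e * (path_cost W t.+1 (B i) w - theta (B i))) -
       u * delta + kappa))%:E <= 1)%E)).
    move=> i x y _ yx [u u0 uP]; exists u => // e e1 t.
    apply: le_trans (uP e e1 t); apply: ge0_le_integral => //.
    by move=> w _; rewrite lee_fin ler_expR lerD2l.
  move=> i.
  have [u u0 [kappa kappa0 uP]] := chernoff_tilt (measurable_path_cost W 1 (B i)) v0
    (vM 1%N (B i) isT) (integral_path_cost Wident Wlight (B i) (ltn0Sn 0)) delta0.
  exists kappa => //; exists u => // e e1 t.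
  pose F (x : #|E|.-tuple R) :=
    (expR (u * (e * (tuple_cost (B i) x - theta (B i))) - u * delta + kappa))%:E.
  rewrite -[X in (X <= _)%E]/(\int[P]_w F (W t.+1 w))%E.
  rewrite (ge0_integral_ident Wident (f := F) (ltn0Sn t) (ltn0Sn 0)); first 1 last.
  - apply/measurable_EFinP; apply: measurableT_comp => //.
    apply: measurable_funD => //; apply: measurable_funB => //.
    do 2 (apply: measurable_funM => //).
    by apply: measurable_funB => //; exact: measurable_tuple_cost.
  - by move=> x; rewrite lee_fin expR_ge0.
  exact: uP.
have /choice [u uP] : forall i, exists u : R, 0 < u /\ forall e : R, `|e| = 1 -> forall t,
    (\int[P]_w (expR (u * (e * (path_cost W t.+1 (B i) w - theta (B i))) -
       u * delta + kappa))%:E <= 1)%E.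
  by move=> i; have [u u0 uP] := kappaP i; exists u.
exists kappa => // n k p exploit kd gap.
pose G i (e c : R) := expR (u i * (e * (c - theta (B i))) - u i * delta + kappa).
have mG i (e : R) : measurable_fun setT (G i e).
  apply: measurableT_comp => //; apply: measurable_funD => //.
  apply: measurable_funB => //; apply: measurable_funM => //.
  by apply: measurable_funM => //; exact: measurable_funB.
have G0 i (e c : R) : 0 <= G i e c by exact: expR_ge0.
pose M i (e : R) w := stake (B i) (G i e) (run W pi w n).
have mM i (e : R) : measurable_fun setT (M i e).
  exact: (measurable_fun_past (measurable_stake (W := W) (n := n) pi_meas (B i) (mG i e))).
have M0 i (e : R) w : 0 <= M i e w by exact: stake_ge0.
have M1 i (e : R) : `|e| = 1 -> (\int[P]_w (M i e w)%:E <= 1)%E.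
  move=> e1; apply: (integral_stake_le1 pi_meas Windep (mG i e) (G0 i e)) => t.
  exact: (uP i).2.
have cover w : \1_[set w | pi (run W pi w n) = p] w <=
    expR (- (kappa * k%:R)) * \sum_i (M i 1 w + M i (- 1) w).
  rewrite indicE; case: (boolP (w \in _)) => [|_]; last first.
    by rewrite mulr_ge0 ?expR_ge0// sumr_ge0// => i _; rewrite addr_ge0.
  rewrite inE /= => wp.
  have := pi_asr (run W pi w n).
  rewrite /asr_choice size_run (negbTE exploit) => /(_ sigma); rewrite wp => est.
  (* If all spanner means were accurate, minimality of the estimate of [p] against that of [sigma]
     would bound the gap by [2 * (d * delta)]. *)
  have [i far] : exists i, delta < `|sample_mean (run W pi w n) (B i) - theta (B i)|.
    apply: contrapT => /forallNP close.
    have := estimate_optimal (mu := theta) (fun p => (a_coefs p).1)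
      (fun p => mean_cost_spanner Wident Wlight p a_coefs) _ est.
    move=> /(_ delta); have := deltaP p gap; rewrite ltNge => /negP no opt.
    by apply: no; apply: opt => i; have /negP := close i; rewrite -leNgt.
  have obs := count_obs_ge pi_asr W w i kd.
  have big e : delta <= e * (sample_mean (run W pi w n) (B i) - theta (B i)) ->
      expR (kappa * k%:R) <= M i e w.
    by apply: stake_large => //; [exact/ltW/(uP i).1|exact: ltW].
  have : expR (kappa * k%:R) <= \sum_i (M i 1 w + M i (- 1) w).
    rewrite (bigD1 i)//=.
    have : expR (kappa * k%:R) <= M i 1 w + M i (- 1) w.
      (* The sign of the deviation tells which of the two stakes on [B i] is large; the other is
         only nonnegative. *)
      have [pos|neg] := leP 0 (sample_mean (run W pi w n) (B i) - theta (B i)).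
        have := big 1; rewrite mul1r; have := M0 i (- 1) w.
        by rewrite ger0_norm// in far; move=> ? /(_ (ltW far)); lra.
      have := big (- 1); rewrite mulN1r; have := M0 i 1 w.
      by rewrite ltr0_norm// in far; move=> ? /(_ (ltW far)); lra.
    have : 0 <= \sum_(j | j != i) (M j 1 w + M j (- 1) w).
      by apply: sumr_ge0 => j _; rewrite addr_ge0.
    lra.
  by rewrite -ler_pdivrMl ?expR_gt0// mulr1 expRN invrK.
rewrite -lee_fin choice_probE//.
have mS : measurable_fun setT (fun w => \sum_i (M i 1 w + M i (- 1) w)).
  by apply: measurable_sum => i; apply: measurable_funD.
have mA := measurable_choice_event W pi_meas n p.
have -> : P [set w | pi (run W pi w n) = p] =
    (\int[P]_w (\1_[set w | pi (run W pi w n) = p] w)%:E)%E.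
  by rewrite integral_indic// setIT.
apply: (@le_trans _ _ (\int[P]_w ((expR (- (kappa * k%:R)))%:E *
    (\sum_i (M i 1 w + M i (- 1) w))%:E))%E).
  apply: ge0_le_integral => //.
  - exact/measurable_EFinP/measurable_indic.
  - by apply: measurable_funeM; exact/measurable_EFinP.
  - by move=> w _; rewrite -EFinM lee_fin.
rewrite ge0_integralZl//; last 2 first.
- exact/measurable_EFinP.
- by move=> w _; rewrite lee_fin sumr_ge0// => i _; rewrite addr_ge0.
rewrite [leRHS]EFinM [leRHS]muleC lee_wpmul2l ?lee_fin ?expR_ge0//.
under eq_integral do rewrite -sumEFin.
rewrite ge0_integral_sum//; last 2 first.
- by move=> i; apply/measurable_EFinP; exact: measurable_funD.
- by move=> i w _; rewrite lee_fin addr_ge0.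
apply: (@le_trans _ _ (\sum_(i < d) 2%:E)%E).
  apply: lee_sum => i _; under eq_integral do rewrite EFinD.
  rewrite ge0_integralD//=; last 4 first.
  - by move=> w _; rewrite lee_fin.
  - exact/measurable_EFinP.
  - by move=> w _; rewrite lee_fin.
  - exact/measurable_EFinP.
  rewrite (_ : 2 = 1 + 1)// EFinD leeD//; apply: M1; rewrite ?normrN normr1//.
by rewrite sumEFin sumr_const card_ord mulr_natr.
Qed.

End ExploitationError.

(** * Summation over time *)

Lemma sum_inv_sqr_le2 (R : realType) T :
  \sum_(1 <= t < T.+1) (t%:R ^- 2) <= 2 :> R.
Proof.
case: T => [|T]; first by rewrite big_geq.
(* The strengthened bound makes the induction telescope: with [x = T.+1], [1 / x - 1 / (x + 1)]
   exceeds [1 / (x + 1) ^+ 2] by exactly [1 / (x * (x + 1) ^+ 2)]. *)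
suff: \sum_(1 <= t < T.+2) (t%:R ^- 2) <= 2 - T.+1%:R^-1 :> R.
  by move/le_trans; apply; rewrite gerBl invr_ge0.
elim: T => [|T IH]; first by rewrite big_nat1 expr1n invr1; lra.
rewrite big_nat_recr//=; apply: (le_trans (lerD IH (lexx _))).
have x0 : 0 < T.+1%:R :> R by rewrite ltr0n.
rewrite -(natr1 T.+1); set x : R := T.+1%:R in x0 *.
have y0 : 0 < x + 1 by rewrite ltr_wpDr.
suff -> : 2 - x^-1 + (x + 1) ^- 2 = 2 - (x + 1)^-1 - (x * (x + 1) ^+ 2)^-1.
  by rewrite gerBl invr_ge0 mulr_ge0// ltW// exprn_gt0.
by field; rewrite !gt_eqF.
Qed.

Lemma sum_explore (R : realType) d (f : nat -> R) T :
  \sum_(1 <= t < T.+1) (t \in explore d f t)%:R = (#|` explore d f T|)%:R :> R.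
Proof.
elim: T => [|T IH]; first by rewrite big_geq// cardfs0.
by rewrite big_nat_recr//= IH card_exploreS natrD.
Qed.

Lemma sum_before (R : realType) N T :
  \sum_(1 <= t < T.+1) (t < N)%N%:R <= N%:R :> R.
Proof.
apply: (@le_trans _ _ (minn T N)%:R); last by rewrite ler_nat geq_minr.
elim: T => [|T IH]; first by rewrite big_geq// min0n.
rewrite big_nat_recr//=; apply: (le_trans (lerD IH (lexx _))).
rewrite -natrD ler_nat; by case: ltnP; lia.
Qed.

Section LogarithmicRegret.
Context (V : finType) (E : {set V * V}) (s r : V) (R : realType)
  (dO : measure_display) (Omega : measurableType dO) (P : probability Omega R)
  (W : nat -> {RV P >-> #|E|.-tuple R}).
Hypothesis Windep : independent_seq W.
Hypothesis Wident : identically_distributed_seq W.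
Hypothesis Wlight : forall (t : nat) (j : 'I_#|E|), (0 < t)%N ->
  light_tailed P (fun w => tnth (W t w) j).
Context (B : 'I_(path_dim E s r R) -> spath E s r)
  (a : spath E s r -> 'I_(path_dim E s r R) -> R)
  (f : nat -> R) (pi : history E s r R -> spath E s r).
Hypothesis a_coefs : spanner_coefs B a.
Hypothesis pi_meas : measurable_policy pi.
Hypothesis pi_asr : is_asr_policy B a f pi.
Hypothesis f_pos : forall t, (0 < t)%N -> 0 < f t.
Hypothesis f_incr : forall t u, (0 < t)%N -> (t <= u)%N -> f t <= f u.
Hypothesis f_infty : f @ \oo --> +oo.
Variable sigma : spath E s r.
Hypothesis sigma_min : min_expected_cost W sigma.
Local Notation d := (path_dim E s r R).

Lemma regret_ge0 T : 0 <= fine (regret W pi sigma T).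
Proof.
rewrite (regretE Wident Wlight pi_meas Windep)/=.
apply: sumr_ge0 => t _; apply: sumr_ge0 => p _.
by rewrite mulr_ge0 ?choice_prob_ge0// subr_ge0 mean_cost_min.
Qed.

(** Each time is charged to exploration, to the initial stretch before [N], or to the tail
    [2 * d * t ^- 2]; the tails sum to at most [4 * d]. *)
Lemma regret_le : exists2 C : R, 0 <= C & exists N : nat, forall T, (0 < T)%N ->
  fine (regret W pi sigma T) <=
  C * (1 + d%:R * (f T * ln T%:R + 1) + N%:R + 4 * d%:R).
Proof.
have [kappa kappa0 err] := exploitation_error Windep Wident Wlight a_coefs
  pi_meas pi_asr sigma.
(* From [N] on, [kappa * f t >= 2], so [expR (- (kappa * k))] with [k >= f t * ln t] is at most
   [t ^- 2]. *)
have [N _ fN] : \forall t \near \oo, 2 / kappa <= f t.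
  by move/cvgryPge : f_infty; exact.
pose gap (p : spath E s r) := mean_cost W p - mean_cost W sigma.
have gap0 (p : spath E s r) : 0 <= gap p by rewrite subr_ge0 mean_cost_min.
pose C := \sum_p gap p.
have C0 : 0 <= C by apply: sumr_ge0 => p _; exact: gap0.
exists C => //; exists N => T T0.
rewrite (regretE Wident Wlight pi_meas Windep)/=.
have step t : (0 < t)%N -> \sum_p choice_prob W pi t.-1 p * gap p <=
    C * ((t \in explore d f t)%:R + (t < N)%N%:R + 2 * d%:R * t%:R ^- 2).
  case: t => // n _; rewrite [n.+1.-1]/= /C mulr_suml; apply: ler_sum => p _.
  (* Other optimal paths have gap 0 and cost nothing; the error bound concerns positive gaps. *)
  rewrite mulrC; have [gap_p|no_gap] := ltP 0 (gap p); last first.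
    have -> : gap p = 0 by apply/eqP; rewrite eq_le no_gap gap0.
    by rewrite !mul0r.
  rewrite ler_pM2l//.
  have tail0 : 0 <= 2 * d%:R * n.+1%:R ^- 2 :> R.
    by rewrite mulr_ge0// invr_ge0 exprn_ge0.
  have le1 := choice_prob_le1 W pi_meas n p.
  have [expl|exploit] := boolP (n.+1 \in explore d f n.+1).
    by apply: (le_trans le1); rewrite (_ : true%:R = 1 :> R)// -addrA lerDl addr_ge0.
  have [early|late] := ltnP n.+1 N.
    by apply: (le_trans le1); rewrite (_ : true%:R = 1 :> R)// addrAC lerDr addr_ge0.
  rewrite (_ : false%:R = 0 :> R)// !add0r.
  have [k kge kd] := card_explore_ge f_pos exploit.
  rewrite subr_gt0 in gap_p.
  apply: (le_trans (err n k p exploit kd gap_p)); rewrite ler_wpM2l//.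
  have pos : 0 < n.+1%:R :> R by rewrite ltr0n.
  have -> : n.+1%:R ^- 2 = expR (- (2 * ln n.+1%:R)) :> R.
    by rewrite expRN expRM_natl lnK ?posrE.
  rewrite ler_expR lerN2.
  apply: (@le_trans _ _ (kappa * (f n.+1 * ln n.+1%:R))); last by rewrite ler_pM2l.
  rewrite mulrA ler_wpM2r ?ln_ge0 ?ler1n//.
  by rewrite mulrC -ler_pdivrMr// fN.
rewrite big_nat.
apply: (@le_trans _ _ (\sum_(1 <= t < T.+1)
   C * ((t \in explore d f t)%:R + (t < N)%N%:R + 2 * d%:R * t%:R ^- 2))).
  by rewrite [leRHS]big_nat; apply: ler_sum => t /andP[t0 _]; exact: step.
rewrite -mulr_sumr ler_wpM2l// !big_split/= sum_explore -mulr_sumr.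
have h1 := card_explore_le d f_pos f_incr T0.
have h2 := sum_before R N T.
have h3 : 2 * d%:R * \sum_(1 <= t < T.+1) t%:R ^- 2 <= 2 * d%:R * 2 :> R.
  by rewrite ler_wpM2l// sum_inv_sqr_le2.
lra.
Qed.

Lemma regret_bigO : (fun T : nat => fine (regret W pi sigma T))
  =O_\oo (fun T : nat => d%:R * f T * ln T%:R).
Proof.
have [C C0 [N regretC]] := regret_le.
(* With [X = d * (f T * ln T)], both 1 and [d] are at most [X], so the five terms
   [1 + X + d + N + 4 * d] are at most [(7 + N) * X]. The final 1 keeps the constant positive when
   [C = 0]. *)
apply/eqO_exP; exists (C * (7 + N%:R) + 1).
  by rewrite ltr_wpDl// mulr_ge0// addr_ge0.
have ln2 : 0 < ln 2%:R :> R by rewrite ln_gt0// ltr1n.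
(* This threshold and [T >= 2] give [f T * ln T >= 1], so the additive constants are absorbed. *)
have : \forall T \near \oo, (ln 2)^-1 <= f T by move/cvgryPge : f_infty; exact.
apply: filterS2 (nbhs_infty_ge 2) => T T2 fT.
have T0 : (0 < T)%N by exact: leq_trans T2.
have d1 : 1 <= d%:R :> R by rewrite ler1n (path_dim_gt0 pi_asr).
have fl1 : 1 <= f T * ln T%:R.
  apply: (@le_trans _ _ ((ln 2)^-1 * ln 2)); first by rewrite mulVf ?gt_eqF.
  apply: ler_pM => //; rewrite ?invr_ge0 ?(ltW ln2)//.
  by rewrite ler_ln ?posrE ?ltr0n// ler_nat.
rewrite ger0_norm ?regret_ge0//.
have X1 : 1 <= d%:R * (f T * ln T%:R).
  by rewrite -[leLHS]mulr1 ler_pM.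
rewrite -mulrA ger0_norm; last exact: le_trans X1.
have dX : d%:R <= d%:R * (f T * ln T%:R) by rewrite ler_peMr.
have NX : N%:R <= N%:R * (d%:R * (f T * ln T%:R)) by rewrite ler_peMr.
apply: (le_trans (regretC T T0)).
set X := d%:R * (f T * ln T%:R) in X1 dX NX *.
have : 1 + d%:R * (f T * ln T%:R + 1) + N%:R + 4 * d%:R <= (7 + N%:R) * X.
  rewrite mulrDr -/X; lra.
move=> /(ler_wpM2l C0); lra.
Qed.

End LogarithmicRegret.

Unset Implicit Arguments.

Theorem theorem2
  (V : finType) (E : {set V * V}) (s r : V)
  (hsr : s != r) (hG : union_of_simple_paths E s r)
  (R : realType) (dO : measure_display) (Omega : measurableType dO)
  (P : probability Omega R)
  (W : nat -> {RV P >-> #|E|.-tuple R})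
  (hW_indep : independent_seq W)
  (hW_ident : identically_distributed_seq W)
  (hW_light : forall (t : nat) (j : 'I_#|E|), (0 < t)%N ->
     light_tailed P (fun w => tnth (W t w) j))
  (sigma1 : spath E s r) (hsigma1 : min_expected_cost W sigma1)
  (B : 'I_(path_dim E s r R) -> spath E s r) (hB : barycentric_spanner B)
  (a : spath E s r -> 'I_(path_dim E s r R) -> R) (ha : spanner_coefs B a)
  (f : nat -> R)
  (hf_pos : forall t, (0 < t)%N -> 0 < f t)
  (hf_incr : forall t u, (0 < t)%N -> (t <= u)%N -> f t <= f u)
  (hf_infty : f @ \oo --> +oo)
  (pi : history E s r R -> spath E s r)
  (hpi_meas : measurable_policy pi)
  (hpi : is_asr_policy B a f pi) :
  (forall T, regret W pi sigma1 T \is a fin_num) /\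
  (fun T : nat => fine (regret W pi sigma1 T))
    =O_\oo (fun T : nat => (path_dim E s r R)%:R * f T * ln T%:R).
Proof.
split; last exact: (regret_bigO hW_indep hW_ident hW_light ha hpi_meas hpi
  hf_pos hf_incr hf_infty hsigma1).
by move=> T; rewrite (regretE hW_ident hW_light hpi_meas hW_indep).
Qed.
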